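(* Suppose observations $(x_i,y_i)$, $i=1,\dots,n$, are generated from $y_i=f(x_i)+\varepsilon_i$ with $\varepsilon_i$ i.i.d. $N(0,\sigma^2)$. Let $\mathbf{B}$ be the $n\times J$ matrix with $\mathbf{B}_{ij}=B_j(x_i)$ (cubic B-spline basis), assumed of full column rank, $\mathbf{f}=(f(x_1),\dots,f(x_n))^T$ and $\mathbf{y}=(y_1,\dots,y_n)^T$. Let $\hat\gamma^{ls}=(\mathbf{B}^T\mathbf{B})^{-1}\mathbf{B}^T\mathbf{y}$ be the unconstrained cubic spline coefficients and $\hat\gamma$ the monotone cubic spline coefficients, i.e. a minimizer of $\|\mathbf{y}-\mathbf{B}\gamma\|_2^2$ subject to $\gamma_1\le\cdots\le\gamma_J$. Let $\mathbf{G}$ be the $g\times J$ ($g<J$) tie matrix of $\hat\gamma$: partition $\{1,\dots,J\}$ into the maximal blocks $I_1,\dots,I_g$ of consecutive indices on which $\hat\gamma$ is constant and set $\mathbf{G}_{rj}=1$ if $j\in I_r$, $0$ otherwise, so that $\mathbf{B}\hat\gamma=\mathbf{H}_g\mathbf{y}$ with $\mathbf{H}_g=\mathbf{B}\mathbf{G}^T(\mathbf{G}\mathbf{B}^T\mathbf{B}\mathbf{G}^T)^{-1}\mathbf{G}\mathbf{B}^T$; treat $\mathbf{G}$ as fixed (non-random). Let $\mathbf{H}=\mathbf{B}(\mathbf{B}^T\mathbf{B})^{-1}\mathbf{B}^T$, $\mathrm{MSE}(\hat{\mathbf{y}})=\mathbb{E}\|\mathbf{H}_g\mathbf{y}-\mathbf{f}\|_2^2$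 and $\mathrm{MSE}(\hat{\mathbf{y}}^{ls})=\mathbb{E}\|\mathbf{B}\hat\gamma^{ls}-\mathbf{f}\|_2^2$. Then $\mathbf{H}-\mathbf{H}_g$ is positive semidefinite, and if $$\sigma^2\ge\frac{\mathbf{f}^T(\mathbf{H}-\mathbf{H}_g)\mathbf{f}}{J-g},$$ then $\mathrm{MSE}(\hat{\mathbf{y}})\le\mathrm{MSE}(\hat{\mathbf{y}}^{ls})$.
   Context: $B_1,\dots,B_J$ are cubic B-spline basis functions on knots $\xi_0<\cdots<\xi_{K+1}$, $J=K+4$ (defined recursively from an augmented knot sequence in the standard Cox–de Boor way). *)

(* Defs.v *)
From HB Require Import structures.
From mathcomp Require Import all_boot all_order all_algebra.
From mathcomp Require Import all_classical all_reals all_analysis.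
Set Implicit Arguments. Unset Strict Implicit. Unset Printing Implicit Defensive.
Import Order.TTheory GRing.Theory Num.Theory.
Local Open Scope classical_set_scope.
Local Open Scope ring_scope.

Section Defs.
Variable R : realType.

(* Augmented knot sequence t_0..t_{K+7}: xi_0 repeated 4 times, the interior
   knots xi_1..xi_K, and xi_{K+1} repeated 4 times. *)
Definition aug_knots (xi : nat -> R) (K : nat) (k : nat) : R :=
  if (k <= 3)%N then xi 0%N
  else if (k <= K + 4)%N then xi (k - 3)%N
  else xi K.+1.

(* order-1 (degree-0) B-splines: indicator of [t_k, t_{k+1}), the last
   non-degenerate interval [t_{K+3}, t_{K+4}] = [xi_K, xi_{K+1}] being closed. *)
Definition bsp0 (K : nat) (t : nat -> R) (k : nat) (x : R) : R :=
  if ((t k <= x) && (x < t k.+1)) || ((k == K + 3)%N && (x == t k.+1))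
  then 1 else 0.

(* degree-p B-spline B_{k,p+1}; Cox--de Boor recursion, with the usual
   convention 0/0 = 0 (automatic in MathComp since 0^-1 = 0). *)
Fixpoint bsp (K : nat) (t : nat -> R) (p k : nat) (x : R) : R :=
  match p with
  | 0%N => bsp0 K t k x
  | p'.+1 =>
      (x - t k) / (t (k + p) - t k) * bsp K t p' k x
      + (t (k + p.+1) - x) / (t (k + p.+1) - t k.+1) * bsp K t p' k.+1 x
  end.

Definition cubic_bspline (xi : nat -> R) (K : nat) (j : 'I_(K + 4)) (x : R) : R :=
  bsp K (aug_knots xi K) 3 j x.

Definition bspline_design (xi : nat -> R) (K n : nat) (x : 'I_n -> R)
  : 'M[R]_(n, K + 4) := \matrix_(i < n, j < K + 4) @cubic_bspline xi K j (x i).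

Definition sqnorm (m : nat) (v : 'cV[R]_m) : R := \sum_(i < m) (v i 0) ^+ 2.

Definition cv_at (m : nat) (v : 'cV[R]_m) (k : nat) : R :=
  match insub k with Some i => v i 0 | None => 0 end.

Definition monotone_cv (m : nat) (v : 'cV[R]_m) : Prop :=
  forall k : nat, (k.+1 < m)%N -> cv_at v k <= cv_at v k.+1.

Definition is_monotone_ls (n J : nat) (B : 'M[R]_(n, J)) (y : 'cV[R]_n)
  (gam : 'cV[R]_J) : Prop :=
  monotone_cv gam /\
  forall gam' : 'cV[R]_J, monotone_cv gam' ->
    sqnorm (y - B *m gam) <= sqnorm (y - B *m gam').

(* 0-based index of the maximal constant block of consecutive indices
   containing index j *)
Definition block_id (m : nat) (v : 'cV[R]_m) (j : nat) : nat :=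
  \sum_(k < j) (cv_at v k != cv_at v k.+1 : nat).

Definition nblocks (m : nat) (v : 'cV[R]_m) : nat := (block_id v m.-1).+1.

Definition tie_matrix (m : nat) (v : 'cV[R]_m) : 'M[R]_(nblocks v, m) :=
  \matrix_(r < nblocks v, j < m) (block_id v j == r)%:R.

Definition hat_mx (n J : nat) (B : 'M[R]_(n, J)) : 'M[R]_n :=
  B *m invmx (B^T *m B) *m B^T.

Definition hat_mx_tie (n J g : nat) (B : 'M[R]_(n, J)) (G : 'M[R]_(g, J))
  : 'M[R]_n :=
  B *m G^T *m invmx (G *m B^T *m B *m G^T) *m G *m B^T.

Definition psd (m : nat) (A : 'M[R]_m) : Prop :=
  forall v : 'cV[R]_m, 0 <= (v^T *m A *m v) 0 0.

End Defs.
Arguments cubic_bspline {R} xi K j x.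
Arguments bspline_design {R} xi K {n} x.

Definition mutually_independent_rv {d} {T : measurableType d} {R : realType}
  (P : probability T R) (n : nat) (X : 'I_n -> T -> R) : Prop :=
  forall A : 'I_n -> set R, (forall i, measurable (A i)) ->
    P (\bigcap_(i in [set: 'I_n]) (X i @^-1` A i)) =
    (\prod_(i < n) P (X i @^-1` A i))%E.

(* Main.v *)
Require Import Defs.
From HB Require Import structures.
From mathcomp Require Import all_boot all_order all_algebra.
From mathcomp Require Import all_classical all_reals all_analysis.
From mathcomp Require Import measurable_realfun ring.
Import Order.TTheory GRing.Theory Num.Theory.
Import numFieldNormedType.Exports.
Local Open Scope classical_set_scope.
Local Open Scope ring_scope.

(* [H] and [Hg] are the orthogonal projections onto the column spaces of [B]
   and [B G^T], and these spaces are nested; so [D = H - Hg] is an orthogonal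
   projection of rank [J - g] with [D Hg = 0].  With [y = f + e], expanding
   [H y - f = (Hg y - f) + D y] gives the pointwise identity
     |H y - f|^2 = |Hg y - f|^2 + e^T D e - f^T D f,
   whose expectation is
     MSE_ls = MSE + sigma^2 (J - g) - f^T D f
   because the errors are uncorrelated, centered, of variance [sigma^2]. *)

(** * Projections onto nested column spaces *)

Lemma sqnormE (R : realType) m (v : 'cV[R]_m) : sqnorm v = (v^T *m v) 0 0.
Proof. by rewrite mxE; apply: eq_bigr => i _; rewrite mxE expr2. Qed.

Lemma sqnorm_ge0 (R : realType) m (v : 'cV[R]_m) : 0 <= sqnorm v.
Proof. by apply: sumr_ge0 => i _; exact: sqr_ge0. Qed.

Lemma sqnorm_eq0 (R : realType) m (v : 'cV[R]_m) : sqnorm v = 0 -> v = 0.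
Proof.
move=> /eqP; rewrite psumr_eq0 => [/allP v0|i _]; last exact: sqr_ge0.
apply/colP => i; rewrite mxE.
by have := v0 i (mem_index_enum i); rewrite sqrf_eq0 => /eqP.
Qed.

Lemma sqnormD (R : realType) m (u v : 'cV[R]_m) :
  sqnorm (u + v) = sqnorm u + (v^T *m u) 0 0 *+ 2 + sqnorm v.
Proof.
rewrite /sqnorm mxE -sumrMnl -!big_split /=; apply: eq_bigr => i _.
by rewrite !mxE sqrrD [v i 0 * _]mulrC.
Qed.

(** If [u B^T B = 0] then [|B u^T|^2 = u B^T B u^T = 0], so [B u^T = 0], and full column rank forces
    [u = 0]. *)
Lemma gram_unitmx (R : realType) n J (B : 'M[R]_(n, J)) :
  \rank B = J -> B^T *m B \in unitmx.
Proof.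
move=> rkB; rewrite -row_free_unit -kermx_eq0; apply/eqP/row_matrixP => i.
rewrite row0; set u := row i _.
have u0 : u *m (B^T *m B) = 0 by rewrite -row_mul mulmx_ker row0.
have Bu0 : B *m u^T = 0.
  apply: sqnorm_eq0; rewrite sqnormE trmx_mul trmxK mulmxA -[u *m _ *m _]mulmxA.
  by rewrite u0 mul0mx mxE.
have /row_freeP[C BC] : row_free B^T by rewrite /row_free mxrank_tr rkB.
by rewrite -[u]mulmx1 -BC mulmxA -[u *m _]trmxK trmx_mul trmxK Bu0 trmx0 mul0mx.
Qed.

Section hat_mx.
Context {R : realType} {n J : nat}.
Implicit Types B : 'M[R]_(n, J).

Lemma trmx_hat_mx B : (hat_mx B)^T = hat_mx B.
Proof. by rewrite /hat_mx !trmx_mul trmxK trmx_inv trmx_mul trmxK mulmxA. Qed.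

Lemma mulmx_hat_mx B : \rank B = J -> hat_mx B *m B = B.
Proof.
by move=> /gram_unitmx uB; rewrite /hat_mx -[_ *m B^T *m B]mulmxA mulmxKV.
Qed.

Lemma mulmx_hat_hat g B (C : 'M[R]_(J, g)) : \rank B = J ->
  hat_mx B *m hat_mx (B *m C) = hat_mx (B *m C).
Proof. by move=> rkB; rewrite /(hat_mx (B *m C)) !mulmxA mulmx_hat_mx. Qed.

Lemma mulmx_hat_mxid B : \rank B = J -> hat_mx B *m hat_mx B = hat_mx B.
Proof. by move=> rkB; rewrite {2}/hat_mx !mulmxA mulmx_hat_mx. Qed.

Lemma mxtrace_hat_mx B : \rank B = J -> \tr (hat_mx B) = J%:R.
Proof.
move=> /gram_unitmx uB.
by rewrite /hat_mx mxtrace_mulC mulmxA mulmxV// mxtrace1.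
Qed.

Lemma hat_mx_tieE g B (G : 'M[R]_(g, J)) : hat_mx_tie B G = hat_mx (B *m G^T).
Proof. by rewrite /hat_mx_tie /hat_mx trmx_mul trmxK !mulmxA. Qed.

End hat_mx.

Section nested_hat_mx.
Context {R : realType} {n J g : nat}.
Variables (B : 'M[R]_(n, J)) (C : 'M[R]_(J, g)).
Hypotheses (rkB : \rank B = J) (rkC : \rank C = g).

Lemma mxrank_mul_full : \rank (B *m C) = g.
Proof.
by rewrite -mxrank_tr trmx_mul mxrankMfree ?mxrank_tr// /row_free mxrank_tr rkB.
Qed.

Local Notation H := (hat_mx B).
Local Notation Hg := (hat_mx (B *m C)).
Local Notation D := (H - Hg).

Lemma trmx_hat_mxB : D^T = D.
Proof. by rewrite linearB /= !trmx_hat_mx. Qed.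

Lemma mulmx_hat_mxBr : D *m Hg = 0.
Proof.
by rewrite mulmxBl mulmx_hat_hat// mulmx_hat_mxid ?subrr// mxrank_mul_full.
Qed.

Lemma mulmx_hat_mxBid : D *m D = D.
Proof.
rewrite mulmxBr mulmx_hat_mxBr subr0 mulmxBl mulmx_hat_mxid//.
(* [Hg H = Hg] is the transpose of [H Hg = Hg], both factors being symmetric. *)
by congr (_ - _); rewrite -[LHS]trmxK trmx_mul !trmx_hat_mx mulmx_hat_hat//
  trmx_hat_mx.
Qed.

(** For a symmetric idempotent [D], [v^T D v = |D v|^2]. *)
Lemma psd_hat_mxB : psd D.
Proof.
move=> v; rewrite -mulmx_hat_mxBid mulmxA -mulmxA -{1}trmx_hat_mxB -trmx_mul.
by rewrite -sqnormE sqnorm_ge0.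
Qed.

Lemma mxtrace_hat_mxB : \tr D = J%:R - g%:R.
Proof. by rewrite linearB /= !mxtrace_hat_mx// mxrank_mul_full. Qed.

(* Write [H y - f = (Hg y - f) + D y]: since [D Hg = 0], the cross term only
   sees [f], and the terms linear in [e] cancel. *)
Lemma sqnorm_hat_mxB (f e : 'cV[R]_n) :
  sqnorm (H *m (f + e) - f) =
  sqnorm (Hg *m (f + e) - f) + (e^T *m D *m e) 0 0 - (f^T *m D *m f) 0 0.
Proof.
have -> : H *m (f + e) - f = (Hg *m (f + e) - f) + D *m (f + e).
  by rewrite mulmxBl addrAC [_ + (_ - _)]addrC subrK.
have DT := trmx_hat_mxB; have DD := mulmx_hat_mxBid.
have DHg := mulmx_hat_mxBr.
move: (H - Hg) DT DD DHg => D; move: Hg => K DT DD DHg.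
rewrite sqnormD -!addrA; congr (_ + _).
rewrite sqnormE !trmx_mul DT !mulmxA -[_ *m D *m D]mulmxA DD mulmxBr !mulmxA.
rewrite -[_ *m D *m K]mulmxA DHg mulmx0 mul0mx sub0r !mulmxDr !linearD/=.
rewrite !mulmxDl.
have -> : f^T *m D *m e = e^T *m D *m f.
  transitivity (f^T *m D *m e)^T; last by rewrite !trmx_mul trmxK DT mulmxA.
  by apply/matrixP => i j; rewrite [RHS]mxE !ord1.
move: (_ *m _) (_ *m _ *m e) (_ *m f) => a b c.
rewrite !mxE; ring.
Qed.

End nested_hat_mx.

(** * Constant blocks and the rank of the tie matrix *)

Lemma block_idS (R : realType) m (v : 'cV[R]_m) k :
  block_id v k.+1 = (block_id v k + (cv_at v k != cv_at v k.+1))%N.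
Proof. by rewrite /block_id big_ord_recr. Qed.

(** Discrete intermediate values: the block index starts at 0 and grows by at most one per step, so
    no block is empty. *)
Lemma block_id_surj (R : realType) m (v : 'cV[R]_m) k r :
  (r <= block_id v k)%N -> exists2 j, (j <= k)%N & block_id v j = r.
Proof.
elim: k => [|k IH] rk.
  by exists 0%N => //; move: rk; rewrite /block_id big_ord0 leqn0 => /eqP ->.
have [/IH[j jk <-]|kr] := leqP r (block_id v k).
  by exists j => //; exact: leqW.
exists k.+1 => //; apply/eqP; rewrite eqn_leq rk andbT block_idS.
by apply: leq_trans kr; rewrite -[leqRHS]addn1 leq_add2l leq_b1.
Qed.

(** Choosing one representative index in each block gives a 0/1 right inverse. For [m = 0] the rank
    is 0 while [nblocks] is 1. *)
Lemma mxrank_tie_matrix (R : realType) m (v : 'cV[R]_m) : (0 < m)%N ->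
  \rank (tie_matrix v) = nblocks v.
Proof.
move=> m0; apply/eqP; rewrite -[_ == _]/(row_free _); apply/row_freeP.
have s_ex (r : 'I_(nblocks v)) : exists j : 'I_m, block_id v j == r.
  have [j jm jr] := @block_id_surj R m v m.-1 r (ltn_ord r).
  have jltm : (j < m)%N by rewrite -(prednK m0).
  by exists (Ordinal jltm); rewrite /= jr.
exists (\matrix_(j, r) (j == xchoose (s_ex r))%:R); apply/matrixP => r r'.
rewrite !mxE (bigD1 (xchoose (s_ex r')))//= big1 => [|j jr']; last first.
  by rewrite !mxE (negbTE jr') mulr0.
by rewrite !mxE eqxx mulr1 addr0 (eqP (xchooseP (s_ex r'))) eq_sym.
Qed.

(** * Moments of the centered normal distribution *)

Lemma ge0_integral_normal_prob (R : realType) (m s : R) (f : R -> \bar R) :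
  measurable_fun setT f -> (forall x, 0 <= f x)%E ->
  (\int[normal_prob m s]_x f x =
   \int[lebesgue_measure]_x (f x * (normal_pdf m s x)%:E))%E.
Proof.
move=> mf f0; have dom := normal_prob_dominates m s.
rewrite -(Radon_Nikodym_SigmaFinite.change_of_variables dom)//.
have mpdf : measurable_fun [set: R] (EFin \o normal_pdf m s).
  by apply/measurable_EFinP; exact: measurable_normal_pdf.
have iRN := Radon_Nikodym_SigmaFinite.f_integrable dom.
apply: ae_eq_integral => //.
- by apply: emeasurable_funM => //; exact: measurable_int iRN.
- exact: emeasurable_funM.
(* The Radon-Nikodym derivative and [normal_pdf] have the same integral over every measurable set,
   hence agree almost everywhere. *)
- apply: ae_eqe_mul2l; apply: integral_ae_eq => // A _ mA.
  by rewrite -Radon_Nikodym_SigmaFinite.f_integral.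
Qed.

(** Folding the line at 0 gives the integral of [g (- x)] plus that of [g x] over the half-line;
    replacing [g] by its reflection swaps the two terms. *)
Lemma ge0_integralT_oppr (R : realType) (f : R -> R) :
  (forall x, 0 <= f x) -> continuous f ->
  (\int[lebesgue_measure]_x (f (- x))%:E = \int[lebesgue_measure]_x (f x)%:E)%E.
Proof.
have half (g : R -> R) : (forall x, 0 <= g x) -> continuous g ->
    (\int[lebesgue_measure]_x (g x)%:E =
     \int[lebesgue_measure]_(x in `[0%R, +oo[) (g (- x))%:E +
     \int[lebesgue_measure]_(x in `[0%R, +oo[) (g x)%:E)%E.
  move=> g0 cg; have mg : measurable_fun [set: R] (EFin \o g).
    by apply/measurable_EFinP; exact: continuous_measurable_fun.
  rewrite -(setUv `]-oo, 0%R[%classic) ge0_integral_setU//=; last 4 first.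
    exact: measurableC.
    by rewrite setUv.
    by move=> x _; rewrite lee_fin.
    exact/disj_setPCl.
  rewrite setCitvl; congr (_ + _)%E.
  (* The endpoint 0 is a null set; adding it and writing it as [- 0] gives the interval the shape
     required by the substitution [x := - x]. *)
  rewrite integral_itv_bndo_bndc; last exact: measurable_funTS.
  rewrite -[X in `]-oo, X]%classic]oppr0 ge0_integration_by_substitutionNy//.
  exact: continuous_subspaceT.
move=> f0 cf; rewrite (half f)// (half (f \o -%R))//=; last first.
  by move=> x; apply: continuous_comp; [exact: opp_continuous|exact: cf].
by rewrite addeC; under [X in (_ + X)%E = _]eq_integral do rewrite opprK.
Qed.

Lemma normal_pdf0_oppr (R : realType) (s x : R) : s != 0 ->
  normal_pdf 0 s (- x) = normal_pdf 0 s x.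
Proof. by move=> s0; rewrite normal_pdfE// /normal_fun !subr0 sqrrN. Qed.

Lemma is_derive_normal_pdf0 (R : realType) (s x : R) : s != 0 ->
  is_derive x (1 : R) (normal_pdf 0 s) (- (x / s ^+ 2) * normal_pdf 0 s x).
Proof.
move=> s0; rewrite normal_pdfE//.
rewrite /normal_fun.
apply: is_derive_eq.
rewrite subr0 /GRing.scale /=.
by field.
Qed.

Lemma cvg_mul_normal_pdf0 (R : realType) (s : R) : s != 0 ->
  n%:R * normal_pdf 0 s n%:R @[n --> \oo] --> (0 : R).
Proof.
move=> s0; rewrite -cvg_shiftS /=.
have hub (n : nat) : n.+1%:R * normal_pdf 0 s n.+1%:R <=
    normal_peak s * (s ^+ 2 *+ 2) * n.+1%:R^-1.
  rewrite normal_pdfE// /normal_fun subr0 mulNr expRN mulrCA -!mulrA.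
  rewrite ler_wpM2l ?normal_peak_ge0//.
  set u := n.+1%:R; have u0 : 0 < u by rewrite ltr0n.
  have c0 : 0 < s ^+ 2 *+ 2 by rewrite pmulrn_lgt0// exprn_even_gt0.
  (* With [t = u^2 / (2 s^2)] the bound is [u / t], so the claim reduces to [t <= expR t], which
     follows from [1 + t <= expR t]. *)
  have -> : s ^+ 2 *+ 2 * u^-1 = u * (u * (u / (s ^+ 2 *+ 2)))^-1.
    by field; rewrite s0 nat1r pnatr_eq0.
  rewrite ler_pM2l// lef_pV2 ?posrE ?expR_gt0 ?mulr_gt0 ?invr_gt0//.
  by apply: le_trans (expR_ge1Dx _); rewrite lerDr.
apply: (@squeeze_cvgr _ _ _ _ (cst 0)
  (fun n => normal_peak s * (s ^+ 2 *+ 2) * n.+1%:R^-1)).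
- by apply: nearW => n; rewrite hub andbT mulr_ge0// normal_pdf_ge0.
- exact: cvg_cst.
- rewrite -[0](mulr0 (normal_peak s * (s ^+ 2 *+ 2))).
  by apply: cvgMr; exact: cvg_harmonic.
Qed.

(* [x * normal_pdf 0 s x] vanishes at infinity and has derivative
   [(1 - x ^+ 2 / s ^+ 2) * normal_pdf 0 s x]. *)
Lemma integral_sqr_normal_pdf0 (R : realType) (s : R) : s != 0 ->
  (\int[lebesgue_measure]_x (x ^+ 2 * normal_pdf 0 s x)%:E = (s ^+ 2)%:E)%E.
Proof.
move=> s0; pose p := @normal_pdf R 0 s.
have p0 x : 0 <= p x by exact: normal_pdf_ge0.
have cp : continuous p by exact: continuous_normal_pdf.
pose q x := x ^+ 2 / s ^+ 2 * p x.
have q0 x : 0 <= q x by rewrite mulr_ge0// divr_ge0// sqr_ge0.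
have cq : continuous q.
  move=> x; apply: cvgM; last exact: cp.
  by apply: cvgM; [exact: sqr_continuous|exact: cvg_cst].
pose F x := x * p x.
have dF x : is_derive x (1 : R) F (p x - q x).
  have := is_derive_normal_pdf0 R s x s0; rewrite -/p => dp.
  by apply: is_derive_eq; rewrite /GRing.scale /= /q; ring.
have cF : continuous F by move=> x; apply: cvgM; [exact: cvg_id|exact: cp].
(* The fundamental theorem of calculus for [F' = p - q], with [F 0 = 0]; the bound [n.+1] keeps the
   interval nondegenerate. *)
have itv_eq n : (\int[lebesgue_measure]_(x in `[0%R, n.+1%:R]) (q x)%:E =
    \int[lebesgue_measure]_(x in `[0%R, n.+1%:R]) (p x)%:E - (F n.+1%:R)%:E)%E.
  have ip : lebesgue_measure.-integrable `[(0:R), n.+1%:R] (EFin \o p).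
    apply: continuous_compact_integrable; first exact: segment_compact.
    exact: continuous_subspaceT.
  have iq : lebesgue_measure.-integrable `[(0:R), n.+1%:R] (EFin \o q).
    apply: continuous_compact_integrable; first exact: segment_compact.
    exact: continuous_subspaceT.
  have := @continuous_FTC2 R (p \- q) F 0 n.+1%:R.
  rewrite ltr0n => /(_ isT) ftc.
  have {ftc} : (\int[lebesgue_measure]_(x in `[0%R, n.+1%:R]) ((p \- q) x)%:E =
      (F n.+1%:R)%:E)%E.
    rewrite ftc; first by rewrite /F mul0r sube0.
    - by apply: continuous_subspaceT => x; apply: cvgB; [exact: cp|exact: cq].
    - by split=> [x _||]; [exact: ex_derive|exact/cvg_at_right_filter/cF|
        exact/cvg_at_left_filter/cF].
    - by move=> x _; rewrite derive1E derive_val.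
  rewrite integralB_EFin//=.
  have /fineK <- : (\int[lebesgue_measure]_(x in `[0%R, n.+1%:R]) (p x)%:E
      \is a fin_num)%E.
    exact: integrable_fin_num ip.
  have /fineK <- : (\int[lebesgue_measure]_(x in `[0%R, n.+1%:R]) (q x)%:E
      \is a fin_num)%E.
    exact: integrable_fin_num iq.
  by rewrite -!EFinB => -[<-]; congr EFin; rewrite subKr.
have lim_p := @ge0_cvgn_integral R lebesgue_measure p p0
  (continuous_measurable_fun cp).
have lim_q := @ge0_cvgn_integral R lebesgue_measure q q0
  (continuous_measurable_fun cq).
(* Let [n] tend to infinity in [itv_eq]: the boundary term [F n.+1%:R] vanishes. *)
have half_eq : (\int[lebesgue_measure]_(x in `[0%R, +oo[) (q x)%:E =
    \int[lebesgue_measure]_(x in `[0%R, +oo[) (p x)%:E)%E.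
  apply: (cvg_unique (@ereal_hausdorff R) lim_q) => /=.
  rewrite -cvg_shiftS /=.
  under eq_cvg do rewrite itv_eq.
  rewrite -(sube0 (\int[lebesgue_measure]_(x in `[0%R, +oo[) (p x)%:E)).
  apply: cvgeB; first by rewrite fin_num_adde_defl.
    by move: lim_p; rewrite -cvg_shiftS.
  apply: cvg_EFin; first exact: nearW.
  by have := cvg_mul_normal_pdf0 R s s0; rewrite -cvg_shiftS.
have even_p x : p (- x) = p x by exact: normal_pdf0_oppr.
(* Both [p] and [q] are even, so equality on the half-line extends to the whole line, where [p] has
   mass 1. *)
have Tq : (\int[lebesgue_measure]_x (q x)%:E = 1)%E.
  rewrite -[RHS](integral_normal_pdf 0 s) -/p.
  rewrite ge0_symfun_integralT//; last first.
    by move=> x; rewrite /q /= even_p sqrrN.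
  rewrite [RHS]ge0_symfun_integralT//; last by move=> x; exact/esym/even_p.
  by rewrite -set_itvcy half_eq.
transitivity ((s ^+ 2)%:E * \int[lebesgue_measure]_x (q x)%:E)%E; last first.
  by rewrite Tq mule1.
rewrite -ge0_integralZl//=; last 3 first.
- by apply/measurable_EFinP; exact: continuous_measurable_fun.
- by move=> x _; rewrite lee_fin.
- by rewrite lee_fin sqr_ge0.
apply: eq_integral => x _.
by rewrite -EFinM /q mulrA mulrCA divff ?expf_neq0// mulr1.
Qed.

(** * Transfer of these moments to a random variable with normal law *)

Section centered_normal_rv.
Context {d} {T : measurableType d} {R : realType} {P : probability T R}.
Variables (X : {RV P >-> R}) (s : R).
Hypothesis s0 : s != 0.
Hypothesis lawX : forall A : set R, measurable A ->
  distribution P X A = normal_prob 0 s A.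

Lemma ge0_expectation_normal (f : R -> R) :
  measurable_fun [set: R] f -> (forall x, 0 <= f x) ->
  ('E_P[f \o X] = \int[lebesgue_measure]_x (f x * normal_pdf 0 s x)%:E)%E.
Proof.
move=> mf f0; rewrite unlock.
(* [normal_prob] is a measure on [measurableTypeR R], whose display differs
   from the default one of [R] used by [distribution]. *)
have mX : measurable_fun [set: T] (X : T -> measurableTypeR R).
  exact: (measurable_funPT X).
have mEf : measurable_fun [set: measurableTypeR R] (EFin \o f).
  exact/measurable_EFinP.
transitivity (\int[pushforward P (X : T -> measurableTypeR R)]_x (f x)%:E)%E.
  by rewrite ge0_integral_pushforward// => x _; rewrite lee_fin.
transitivity (\int[normal_prob 0 s]_x (f x)%:E)%E.
  by apply: eq_measure_integral => A mA _; exact: lawX.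
by rewrite ge0_integral_normal_prob.
Qed.

Lemma expectation_sqr_normal : ('E_P[(fun w => X w ^+ 2)%R] = (s ^+ 2)%:E)%E.
Proof.
rewrite -[LHS]/('E_P[(fun x : R => x ^+ 2)%R \o X])%E ge0_expectation_normal.
- exact: integral_sqr_normal_pdf0.
- exact: measurable_funX.
- by move=> x; exact: sqr_ge0.
Qed.

(** The second moment integrates a nonnegative function, so it could be computed before any
    integrability was known; its finiteness now gives membership in L2. *)
Lemma Lfun2_normal : (X : T -> R) \in Lfun P 2%:E.
Proof.
rewrite inE; apply/andP; split; rewrite inE//=.
rewrite /finite_norm unlock poweR_lty//.
under eq_integral do rewrite /= powR_mulrn// real_normK ?num_real//.
by have := expectation_sqr_normal; rewrite unlock => ->; rewrite ltry.
Qed.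

Lemma Lfun1_normal : (X : T -> R) \in Lfun P 1.
Proof. by apply: Lfun_subset12 Lfun2_normal; exact: fin_num_measure. Qed.

Lemma expectation_normal : ('E_P[X] = 0)%E.
Proof.
have iX : P.-integrable [set: T] (EFin \o X).
  exact/Lfun1_integrable/Lfun1_normal.
have cp : continuous (@normal_pdf R 0 s) by exact: continuous_normal_pdf.
pose pos (x : R) := Num.max x 0.
have cpos : continuous pos.
  by move=> x; apply: continuous_max; [exact: cvg_id|exact: cvg_cst].
have pos0 x : 0 <= pos x by rewrite le_max lexx orbT.
have mpos : measurable_fun [set: R] pos by exact: continuous_measurable_fun.
(* The density is even, so the positive and negative parts of [X] have equal expectations; these are
   finite, so their difference is 0. *)
have posE : ('E_P[pos \o X] = 'E_P[(pos \o -%R) \o X])%E.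
  have mposN : measurable_fun [set: R] (pos \o -%R).
    apply: continuous_measurable_fun => x.
    by apply: continuous_comp; [exact: opp_continuous|exact: cpos].
  rewrite !ge0_expectation_normal//; last by move=> x; exact: pos0.
  rewrite -[LHS]ge0_integralT_oppr.
  - apply: eq_integral => x _ /=.
    by rewrite normal_pdf0_oppr.
  - by move=> x; rewrite mulr_ge0// normal_pdf_ge0.
  - by move=> x; apply: cvgM; [exact: cpos|exact: cp].
have ipos := integrable_funepos measurableT iX.
rewrite unlock integralE.
suff <- : (\int[P]_x (EFin \o X)^\+ x = \int[P]_x (EFin \o X)^\- x)%E.
  by rewrite subee// integrable_fin_num.
move: posE; rewrite unlock => posE.
transitivity (\int[P]_w ((pos \o X) w)%:E)%E.
  by apply: eq_integral => w _; rewrite funeposE /= -EFin_max.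
rewrite posE; apply: eq_integral => w _.
by rewrite funenegE /= -EFin_max.
Qed.

End centered_normal_rv.

(** * Independence and quadratic forms *)

Lemma independent_pair (d : measure_display) (T : measurableType d)
    (R : realType) (P : probability T R) (n : nat) (X : 'I_n -> T -> R)
    i j (A B : set R) :
  mutually_independent_rv P X -> i != j -> measurable A -> measurable B ->
  P (X i @^-1` A `&` X j @^-1` B) = (P (X i @^-1` A) * P (X j @^-1` B))%E.
Proof.
move=> indep ij mA mB.
(* Mutual independence applied with the full space at all other indices, where the factors are 1. *)
pose C k := if k == i then A else if k == j then B else setT.
have Ci : C i = A by rewrite /C eqxx.
have Cj : C j = B by rewrite /C eq_sym (negbTE ij) eqxx.
have CT k : k != i -> k != j -> C k = setT.
  by rewrite /C => /negbTE -> /negbTE ->.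
have -> : X i @^-1` A `&` X j @^-1` B =
    \bigcap_(k in [set: 'I_n]) (X k @^-1` C k).
  apply/seteqP; split=> w /=.
    move=> [Aw Bw] k _; have [->|ki] := eqVneq k i; first by rewrite Ci.
    by have [->|kj] := eqVneq k j; rewrite ?Cj//= CT.
  by move=> Cw; rewrite -Ci -Cj; split; exact: Cw.
rewrite indep => [|k]; last by rewrite /C; case: ifP => // _; case: ifP.
rewrite (bigD1 i)//= (bigD1 j)/=; last by rewrite eq_sym.
rewrite Ci Cj big1 ?mule1// => k /andP[ki kj].
by rewrite CT// preimage_setT probability_setT.
Qed.

(** The joint law and the product of the marginal laws agree on rectangles, hence everywhere; Fubini
    then factors the integral of the product. *)
Lemma expectationM_independent (d : measure_display) (T : measurableType d)
    (R : realType) (P : probability T R) (X Y : {RV P >-> R}) :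
  (forall A B : set R, measurable A -> measurable B ->
    P (X @^-1` A `&` Y @^-1` B) = (P (X @^-1` A) * P (Y @^-1` B))%E) ->
  (X : T -> R) \in Lfun P 2%:E -> (Y : T -> R) \in Lfun P 2%:E ->
  ('E_P[X \* Y] = 'E_P[X] * 'E_P[Y])%E.
Proof.
move=> indep L2X L2Y; pose Z w := (X w, Y w).
have mZ : measurable_fun [set: T] Z by exact: measurable_fun_pair.
pose g (z : R * R) := (z.1 * z.2)%:E.
have mg : measurable_fun [set: R * R] g.
  by apply/measurable_EFinP; apply: measurable_funM.
have L1X : (X : T -> R) \in Lfun P 1.
  by apply: Lfun_subset12 L2X; exact: fin_num_measure.
have L1Y : (Y : T -> R) \in Lfun P 1.
  by apply: Lfun_subset12 L2Y; exact: fin_num_measure.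
have igZ : P.-integrable [set: T] (g \o Z).
  by have /Lfun1_integrable := Lfun2_mul_Lfun1 L2X L2Y.
pose mX := distribution P X; pose mY := distribution P Y.
have eq_law (h : R * R -> \bar R) :
    (\int[mX \x mY]_z h z = \int[pushforward P Z]_z h z)%E.
  apply: eq_measure_integral => A mA _.
  by apply: product_measure_unique mA => B C mB mC; exact: indep.
(* Fubini needs integrability under the product law; it comes from that of [X * Y], a product of two
   L2 variables. *)
have ig : (mX \x mY)%E.-integrable [set: R * R] g.
  apply/integrableP; split=> //; rewrite eq_law.
  by have /integrableP[] := integrable_pushforward mZ mg igZ measurableT.
have fin_EY : ('E_P[Y])%E \is a fin_num by exact: expectation_fin_num.
have int_law (W : {RV P >-> R}) : (W : T -> R) \in Lfun P 1 ->
    (distribution P W).-integrable [set: R] EFin /\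
    (\int[distribution P W]_x x%:E = 'E_P[W])%E.
  move=> /Lfun1_integrable iW; split.
    have mW : measurable_fun [set: T] W by [].
    exact: (integrable_pushforward mW _ iW measurableT).
  by rewrite unlock; exact: (@integral_distribution _ _ _ _ _ P W EFin).
have [iX intX] := int_law X L1X; have [iY intY] := int_law Y L1Y.
rewrite [in LHS]unlock -[LHS]/(\int[P]_w (g \o Z) w)%E.
rewrite -(integral_pushforward mZ mg igZ measurableT) -eq_law.
rewrite -integral12_prod_meas1// -(fineK fin_EY) -intX -integralZr//.
apply: eq_integral => x _; rewrite fineK// -intY -integralZl//.
Qed.

Section quadratic_form.
Context {d} {T : measurableType d} {R : realType} {P : probability T R}.
Context {n : nat}.
Variables (Z : 'I_n -> T -> R) (c : R).
Hypothesis L1Z : forall i j, Z i \* Z j \in Lfun P 1.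

Let F (A : 'M[R]_n) (p : 'I_n * 'I_n) : T -> R :=
  A p.1 p.2 \o* (Z p.1 \* Z p.2).

Let L1F A p : F A p \in Lfun P 1.
Proof. exact: Lfun_scale. Qed.

(** The double sum is presented as a sum over a list of functions, the shape that [expectation_sum]
    takes. *)
Let quadraticE (A : 'M[R]_n) :
  (fun w => ((\col_i Z i w)^T *m A *m (\col_i Z i w)) 0 0) =
  \sum_(X <- [seq F A p | p <- index_enum (('I_n * 'I_n)%type)]) X.
Proof.
apply/funext => w; rewrite big_map fct_sumE mxE.
under eq_bigr do rewrite mxE mulr_suml.
rewrite exchange_big pair_big; apply: eq_bigr => -[i j] _ /=.
by rewrite !mxE /F /=; ring.
Qed.

Lemma Lfun1_quadratic_form (A : 'M[R]_n) :
  (fun w => ((\col_i Z i w)^T *m A *m (\col_i Z i w)) 0 0) \in Lfun P 1.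
Proof. by rewrite quadraticE big_map rpred_sum// => p _; exact: L1F. Qed.

Lemma expectation_quadratic_form (A : 'M[R]_n) :
  (forall i j, 'E_P[Z i \* Z j] = ((i == j)%:R * c)%:E)%E ->
  ('E_P[(fun w => ((\col_i Z i w)^T *m A *m (\col_i Z i w)) 0 0)%R] =
   (c * \tr A)%:E)%E.
Proof.
move=> EZ; rewrite quadraticE expectation_sum => [|X /mapP[p _ ->]]; last first.
  exact: L1F.
rewrite big_map; under eq_bigr do rewrite expectationZl// EZ -EFinM.
rewrite sumEFin; congr EFin.
rewrite -(pair_big xpredT xpredT (fun i j => A i j * ((i == j)%:R * c))) /=.
rewrite /mxtrace mulr_sumr; apply: eq_bigr => i _.
(* Uncorrelatedness kills the off-diagonal terms, leaving [c * A i i]. *)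
rewrite (bigD1 i)//= eqxx mul1r mulrC big1 ?addr0// => j ji.
by rewrite eq_sym (negbTE ji) mul0r mulr0.
Qed.

End quadratic_form.

(** The square expands into a constant, a linear form and a quadratic form, each integrable. This
    makes the risk of the tied fit finite, so that expectations can be split. *)
Lemma Lfun1_sqnorm_affine (d : measure_display) (T : measurableType d)
    (R : realType) (P : probability T R) (n m : nat) (Z : 'I_n -> T -> R)
    (M : 'M[R]_(m, n)) (u : 'cV[R]_m) :
  (forall i, Z i \in Lfun P 1) -> (forall i j, Z i \* Z j \in Lfun P 1) ->
  (fun w => sqnorm (u + M *m \col_i Z i w)) \in Lfun P 1.
Proof.
move=> L1Z L1ZZ.
have -> : (fun w => sqnorm (u + M *m \col_i Z i w)) =
    (cst (sqnorm u) \+ \sum_(i < n) ((M^T *m u) i 0 *+ 2) \o* Z i) \+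
    (fun w => ((\col_i Z i w)^T *m (M^T *m M) *m (\col_i Z i w)) 0 0).
  apply/funext => w /=; rewrite sqnormD; congr (_ + _); last first.
    by rewrite sqnormE trmx_mul !mulmxA.
  congr (_ + _); rewrite fct_sumE trmx_mul -mulmxA mxE -sumrMnl.
  apply: eq_bigr => i _; rewrite mxE /= mulrnAr; congr (_ * _ *+ 2).
  by rewrite mxE.
rewrite rpredD ?Lfun1_quadratic_form// rpredD ?Lfun_cst//.
by rewrite rpred_sum// => i _; exact: Lfun_scale.
Qed.

(** * Comparison of the two mean squared errors *)

Theorem theorem4 (R : realType) (d : measure_display) (Omega : measurableType d)
  (P : probability Omega R)
  (K n : nat) (xi : nat -> R) (x : 'I_n -> R) (f : R -> R) (sigma : R)
  (eps : 'I_n -> {RV P >-> R}) (y0 : 'cV[R]_n) (gamhat : 'cV[R]_(K + 4)) :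
  (forall k : nat, (k <= K)%N -> xi k < xi k.+1) ->
  0 < sigma ->
  (forall i (A : set R), measurable A ->
     distribution P (eps i) A = normal_prob 0 sigma A) ->
  mutually_independent_rv P (fun i => (eps i : Omega -> R)) ->
  let B := bspline_design xi K x in
  \rank B = (K + 4)%N ->
  is_monotone_ls B y0 gamhat ->
  let g := nblocks gamhat in
  let G := tie_matrix gamhat in
  (g < K + 4)%N ->
  let fv : 'cV[R]_n := \col_i f (x i) in
  let y : Omega -> 'cV[R]_n := fun w => \col_i (f (x i) + eps i w) in
  let H := hat_mx B in
  let Hg := hat_mx_tie B G in
  psd (H - Hg) /\
  (sigma ^+ 2 >= (fv^T *m (H - Hg) *m fv) 0 0 / (K + 4 - g)%:R ->
   ('E_P[fun w => sqnorm (Hg *m y w - fv)]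
      <= 'E_P[fun w => sqnorm (B *m (invmx (B^T *m B) *m B^T *m y w) - fv)])%E).
Proof.
move=> _ sigma0 law indep B rkB _ g G gK fv y H Hg.
have rkG : \rank G^T = g by rewrite mxrank_tr mxrank_tie_matrix// addn4.
have HgE : Hg = hat_mx (B *m G^T) by exact: hat_mx_tieE.
have s0 : sigma != 0 by rewrite gt_eqF.
split; first by rewrite HgE; exact: psd_hat_mxB.
(* Since [g < K + 4], the denominator is positive and the truncated subtraction is a true one. *)
rewrite ler_pdivrMr ?ltr0n ?subn_gt0// natrB ?(ltnW gK)// => le_sigma.
pose e w : 'cV[R]_n := \col_i eps i w.
have yE w : y w = fv + e w by apply/colP => i; rewrite !mxE.
have L2 i : (eps i : Omega -> R) \in Lfun P 2%:E.
  exact: Lfun2_normal s0 (law i).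
have L1 i : (eps i : Omega -> R) \in Lfun P 1 by exact: Lfun1_normal s0 (law i).
have L1M i j : (eps i : Omega -> R) \* eps j \in Lfun P 1.
  exact: Lfun2_mul_Lfun1.
(* The diagonal is the variance; off the diagonal, independence reduces to a product of zero
   means. *)
have EM i j : ('E_P[(eps i : Omega -> R) \* eps j] =
    ((i == j)%:R * sigma ^+ 2)%:E)%E.
  have [<-|ij] := eqVneq i j.
    by rewrite mul1r -(expectation_sqr_normal _ _ s0 (law i)).
  rewrite mul0r expectationM_independent//; last first.
    by move=> A C mA mC; exact: independent_pair indep ij mA mC.
  by rewrite (expectation_normal _ _ s0 (law i)) mul0e.
pose Q w := ((e w)^T *m (H - Hg) *m e w) 0 0.
have L1Q : Q \in Lfun P 1 by exact: Lfun1_quadratic_form.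
have EQ : ('E_P[Q] = (sigma ^+ 2 * ((K + 4)%:R - g%:R))%:E)%E.
  rewrite (expectation_quadratic_form _ _ _ _ EM)//; congr (_ * _)%:E.
  by rewrite HgE mxtrace_hat_mxB.
pose S w := sqnorm (Hg *m y w - fv).
have L1S : S \in Lfun P 1.
  rewrite (_ : S = fun w => sqnorm ((Hg *m fv - fv) + Hg *m e w)).
    exact: Lfun1_sqnorm_affine.
  by apply/funext => w; rewrite /S yE mulmxDr addrAC.
pose c := (fv^T *m (H - Hg) *m fv) 0 0.
(* The pointwise identity, grouped so that the expectation of [Q \- cst c] is exactly the gap
   between the two risks, nonnegative by [le_sigma]. *)
have -> : (fun w => sqnorm (B *m (invmx (B^T *m B) *m B^T *m y w) - fv)) =
    S \+ (Q \- cst c).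
  apply/funext => w; rewrite /= addrA /S /Q /c yE HgE -sqnorm_hat_mxB//.
  by rewrite /hat_mx !mulmxA.
rewrite expectationD// ?rpredB ?Lfun_cst//.
rewrite expectationB ?Lfun_cst// EQ expectation_cst.
by rewrite leeDl// sube_ge0// lee_fin.
Qed.
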